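(* Every cubic (i.e., $3$-regular) graph is balanceable.
   Context: All graphs are finite, simple and undirected. A $2$-coloring of the edges of the complete graph $K_n$ is a map $\varphi: E(K_n)\to\{R,B\}$. Such a coloring contains a balanced copy of a graph $G$ if there is a subgraph of $K_n$ isomorphic to $G$ whose edge set $E$ can be partitioned into $E_1,E_2$ with $||E_1|-|E_2||\le 1$, $\varphi(e)=R$ for all $e\in E_1$ and $\varphi(e)=B$ for all $e\in E_2$. For a graph $G$ and positive integer $n$, $\mathrm{bal}(n,G)$ is the smallest integer, if it exists, satisfying $\mathrm{bal}(n,G)<\lfloor \frac12\binom n2\rfloor$ such that every $2$-coloring $\varphi$ of $E(K_n)$ with $|\varphi^{-1}(R)|>\mathrm{bal}(n,G)$ and $|\varphi^{-1}(B)|>\mathrm{bal}(n,G)$ contains a balanced copy of $G$. A graph $G$ is balanceable if there exists an integer $n_0$ such that $\mathrm{bal}(n,G)$ exists for every integer $n\ge n_0$. *)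

(* Defs.v *)
From HB Require Import structures.
From mathcomp Require Import all_boot all_order all_algebra.
Set Implicit Arguments.
Unset Strict Implicit.
Unset Printing Implicit Defensive.

Record sgraph := SGraph {
  vertex :> finType;
  adj : rel vertex;
  adj_sym : symmetric adj;
  adj_irrefl : irreflexive adj }.

Definition edges (G : sgraph) : {set {set G}} :=
  [set A : {set G} | [exists x : G, exists y : G, adj x y && (A == [set x; y])]].

Definition degree (G : sgraph) (x : G) : nat := #|[set y : G | adj x y]|.

Definition cubic (G : sgraph) : Prop := forall x : G, degree x = 3.

Lemma neq_op_sym (T : eqType) : symmetric (fun x y : T => x != y).
Proof. by move=> x y; rewrite eq_sym. Qed.

Lemma neq_op_irrefl (T : eqType) : irreflexive (fun x y : T => x != y).
Proof. by move=> x; rewrite eqxx. Qed.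

Definition Kn (n : nat) : sgraph :=
  @SGraph 'I_n (fun x y => x != y) (@neq_op_sym 'I_n) (@neq_op_irrefl 'I_n).

Definition color : eqType := bool.
Definition Red : color := true.
Definition Blue : color := false.

(* A 2-coloring of E(K_n) is represented by a total function on vertex sets;
   its values outside [edges (Kn n)] are never used. *)
Definition coloring (n : nat) : Type := {set Kn n} -> color.

Definition color_class (n : nat) (phi : coloring n) (c : color)
    : {set {set Kn n}} :=
  [set A in edges (Kn n) | phi A == c].

Definition is_subgraph (H : sgraph) (V : {set H}) (E : {set {set H}}) : Prop :=
  E \subset edges H /\ (forall A, A \in E -> A \subset V).

(* For [is_subgraph V E], this says that [f] is an isomorphism from [G] onto
   the graph (V, E). *)
Definition is_iso_onto (G H : sgraph) (V : {set H}) (E : {set {set H}})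
    (f : G -> H) : Prop :=
  [/\ injective f,
      f @: [set: G] = V &
      forall x y : G, ([set f x; f y] \in E) = adj x y].

Definition balanced_edge_set (n : nat) (phi : coloring n)
    (E : {set {set Kn n}}) : Prop :=
  exists E1 E2 : {set {set Kn n}},
    [/\ E1 :|: E2 = E,
        E1 :&: E2 = set0,
        absz (Posz #|E1| - Posz #|E2|)%R <= 1,
        (forall A, A \in E1 -> phi A = Red) &
        (forall A, A \in E2 -> phi A = Blue)].

Definition contains_balanced_copy (n : nat) (phi : coloring n) (G : sgraph)
    : Prop :=
  exists (V : {set Kn n}) (E : {set {set Kn n}}),
    [/\ is_subgraph V E,
        exists f : G -> Kn n, is_iso_onto V E f &
        balanced_edge_set phi E].

Definition bal_bound (n : nat) (G : sgraph) (k : nat) : Prop :=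
  k < 'C(n, 2)./2 /\
  forall phi : coloring n,
    k < #|color_class phi Red| -> k < #|color_class phi Blue| ->
    contains_balanced_copy phi G.

(* [is_bal n G k] says that bal(n, G) exists and equals k.  Candidates range
   over the nonnegative integers: over all of Z there would be no least one
   when every coloring contains a balanced copy, e.g. for edgeless [G]. *)
Definition is_bal (n : nat) (G : sgraph) (k : nat) : Prop :=
  bal_bound n G k /\ (forall k', bal_bound n G k' -> k <= k').

Definition balanceable (G : sgraph) : Prop :=
  exists n0 : nat, forall n : nat, n0 <= n -> exists k : nat, is_bal n G k.

(* Main.v *)
Require Import Defs.
From mathcomp Require Import all_boot all_order all_algebra.
From mathcomp Require Import zify.
From Stdlib Require Import Classical.
Set Implicit Arguments.
Unset Strict Implicit.
Unset Printing Implicit Defensive.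

(** Suppose both colors are used on at least half (rounded down) of the edges
of a large K_n.  By Kővári–Sós–Turán the graph of each color contains a large
complete bipartite graph; by Ramsey's theorem each side contains a large
monochromatic clique.  If one of these cliques has the opposite color, it
already forms, with a clique on the other side, a pattern: two disjoint cliques
A and B, monochromatic of colors c1 and c2, joined by edges of one color c3,
where c1, c2, c3 are not all equal.  Otherwise there are both a large red and a
large blue clique, and a monochromatic complete bipartite graph between them
again gives such a pattern.

A cubic graph G has a vertex set S spanning at most one edge and such that as
many edges cross between S and its complement as lie inside the complement.
By counting degrees, the latter condition says 4|S| = |G| + 2 e(S), so when
|G| = 4k an independent set of size k will do, and when |G| = 4k + 2 a set of
k + 1 vertices inducing one edge.  Both are found greedily, since each new
vertex enlarges the closed neighborhood by at most 4.

After possibly exchanging A and B we have c2 <> c3.  Mapping S into A and its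
complement into B, the edges leaving S and those avoiding S receive opposite
colors and are equally many, so the at most one edge inside S is harmless. *)

(** * Unavoidable patterns *)

Section Ramsey.
Variable T : finType.
Implicit Types (e h : rel T) (P Q A B S : {set T}).

Lemma subset_card_eq P k : k <= #|P| -> exists2 A : {set T}, A \subset P & #|A| = k.
Proof.
elim: k => [|k IH] hk; first by exists set0; rewrite ?sub0set ?cards0.
have [A sAP cA] := IH (ltnW hk).
have /properP[_ [x xP xA]] : A \proper P by rewrite properEcard sAP cA.
by exists (x |: A); rewrite ?subUset ?sub1set ?xP ?cardsU1 ?xA ?cA.
Qed.

(** Averaging: values below [M / (2 * d)] add up to at most half of the guaranteed total
    [#|P| * M / d], so values that are each at most [M] must supply the other half. *)
Lemma many_large_values P (f : T -> nat) M d :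
    0 < M -> (forall x, x \in P -> f x <= M) ->
    #|P| * M <= d * \sum_(x in P) f x ->
  #|P| <= 2 * d * #|[set x in P | M <= 2 * d * f x]|.
Proof.
move=> M0 fM hP; set G := [set x in P | _].
have hS : 2 * d * \sum_(x in P) f x <= 2 * d * (#|G| * M) + #|P| * M.
  rewrite -!sum_nat_const big_distrr [X in X + _]big_distrr /=.
  rewrite [X in _ <= X + _](eq_bigl (fun x => (x \in P) && (M <= 2 * d * f x)));
    last by move=> x; rewrite inE.
  rewrite big_mkcondr -big_split /=.
  apply: leq_sum => x xP; case: (leqP M (2 * d * f x)) => hx /=; last exact: ltnW.
  by apply: leq_trans (leq_addr _ _); rewrite leq_mul2l fM ?orbT.
rewrite -(leq_pmul2r M0).
by nia.
Qed.

Lemma degree_sumC e P Q :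
  \sum_(a in P) #|[set b in Q | e a b]| = \sum_(b in Q) #|[set a in P | e a b]|.
Proof.
have E e' P' Q' : \sum_(a in P') #|[set b in Q' | e' a b]| =
    \sum_(a in P') \sum_(b in Q') e' a b.
  apply: eq_bigr => a _; rewrite -sum1dep_card big_mkcondr /=.
  by apply: eq_bigr => b _; case: (e' a b).
by rewrite E exchange_big (E (fun b a => e a b)).
Qed.

(** With [s = 32 * t.+1], this is [16 * s * 2 ^ s]: it exceeds both [16 * s], needed on the left,
    and [32 * t * 2 ^ s], needed on the right. *)
Definition kst_bound t := 512 * t.+1 * 2 ^ (32 * t.+1).

Lemma pigeonhole_fiber (U : finType) (f : T -> U) P (D : {set U}) t :
    (forall x, x \in P -> f x \in D) -> #|D| * t < #|P| ->
  exists2 u, u \in D & t < #|[set x in P | f x == u]|.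
Proof.
move=> fD hP; apply/exists_inP; apply: contraTT hP.
rewrite negb_exists_in -leqNgt => /forall_inP small.
rewrite -sum1_card (partition_big f (mem D)) //= -sum_nat_const.
apply: leq_sum => u uD; rewrite sum1dep_card leqNgt.
exact: small.
Qed.

(** Averaging on the left gives [s] vertices of large degree; averaging on the right gives many
    vertices with more than [t] neighbors among these [s]. By pigeonhole over the [2 ^ s] subsets,
    more than [t] of them share one neighborhood. *)
Lemma kovari_sos_turan e P Q t :
    kst_bound t <= #|P| -> kst_bound t <= #|Q| ->
    #|P| * #|Q| <= 8 * \sum_(a in P) #|[set b in Q | e a b]| ->
  exists A B, [/\ A \subset P, B \subset Q, t <= #|A|, t <= #|B| &
    {in A & B, forall a b, e a b}].
Proof.
rewrite /kst_bound; set p := 2 ^ _ => hP hQ dens.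
have p0 : 0 < p by rewrite expn_gt0.
set s := 32 * t.+1.
have Q0 : 0 < #|Q| by nia.
have /(many_large_values Q0) := dens.
have deg_le a : a \in P -> #|[set b in Q | e a b]| <= #|Q|.
  by move=> _; apply/subset_leq_card/subsetP => b; rewrite inE => /andP[].
move=> /(_ deg_le); set A1 := [set a in P | _] => hA1.
have sA1 : s <= #|A1| by rewrite /s; nia.
have [A' sA' cA'] := subset_card_eq sA1.
have hsum : #|Q| * s <= 16 * \sum_(b in Q) #|[set a in A' | e a b]|.
  rewrite -degree_sumC -cA' mulnC -sum_nat_const big_distrr /=.
  apply: leq_sum => a /(subsetP sA'); rewrite inE => /andP[_].
  by rewrite -mulnA; lia.
have s0 : 0 < s by [].
have deg_le' b : b \in Q -> #|[set a in A' | e a b]| <= s.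
  by move=> _; rewrite -cA'; apply/subset_leq_card/subsetP => a; rewrite inE => /andP[].
have := many_large_values s0 deg_le' hsum.
set B1 := [set b in Q | _] => hB1.
have [||D] := @pigeonhole_fiber _ (fun b => [set a in A' | e a b]) B1 (powerset A') t.
- by move=> b _; rewrite powersetE; apply/subsetP => a; rewrite inE => /andP[].
- rewrite card_powerset cA' -/s -/p; nia.
rewrite powersetE => sD; set B := [set b in B1 | _] => tB.
have BE b : b \in B -> b \in Q /\ D = [set a in A' | e a b] /\ t.+1 <= #|D|.
  rewrite !inE => /andP[/andP[bQ hb] /eqP DE]; split=> //; split=> //.
  by move: hb; rewrite DE /s; lia.
have [b0 b0B] : exists b0, b0 \in B by apply/card_gt0P; lia.
exists D, B; split.
- apply: subset_trans sD (subset_trans sA' _).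
  by apply/subsetP => a; rewrite inE => /andP[].
- by apply/subsetP => b /BE[].
- by have [_ [_ /ltnW]] := BE _ b0B.
- exact: ltnW.
- by move=> a b aD /BE[_ [DE _]]; move: aD; rewrite DE inE => /andP[].
Qed.

(** * Two-color Ramsey theorem *)

Definition mono h (c : bool) A := {in A &, forall x y, x != y -> h x y = c}.

Lemma monoS h c A B : A \subset B -> mono h c B -> mono h c A.
Proof. by move=> /subsetP sAB hB x y /sAB xB /sAB yB; exact: hB. Qed.

Lemma mono_setU1 h c A v : symmetric h ->
  mono h c A -> {in A, forall x, h v x = c} -> mono h c (v |: A).
Proof.
move=> hs hA hv x y /setU1P[->|xA] /setU1P[->|yA] nxy.
- by rewrite eqxx in nxy.
- exact: hv.
- by rewrite hs hv.
- exact: hA.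
Qed.

Lemma ramsey h P r s : symmetric h -> 2 ^ (r + s) <= #|P| ->
  exists A, A \subset P /\
    ((mono h true A /\ r <= #|A|) \/ (mono h false A /\ s <= #|A|)).
Proof.
move=> hs; have [m] := ubnP (r + s); elim: m => // m IH in r s P *.
move=> hm hP.
have mono0 c : mono h c set0 by move=> x y; rewrite inE.
case: r => [|r] in hm hP *; first by exists set0; split; [exact: sub0set | left].
case: s => [|s] in hm hP *; first by exists set0; split; [exact: sub0set | right].
have [v vP] : exists v, v \in P.
  by apply/card_gt0P; apply: leq_trans hP; rewrite expn_gt0.
pose N c := [set x in P :\ v | h v x == c].
have cP : #|P| = (#|N true| + #|N false|).+1.
  rewrite (cardsD1 v) vP add1n -(cardsID [set x | h v x] (P :\ v)).
  congr (_ + _).+1; apply: eq_card => x; rewrite !inE;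
    by case: (h v x); rewrite ?andbT ?andbF.
have NP c x : x \in N c -> [/\ x \in P, x != v & h v x = c].
  by rewrite !inE => /andP[/andP[-> ->] /eqP].
have subN c A : A \subset N c -> v |: A \subset P.
  move=> /subsetP sA; rewrite subUset sub1set vP; apply/subsetP => x /sA.
  by case/NP.
have ext c A : A \subset N c -> mono h c A ->
    mono h c (v |: A) /\ #|v |: A| = #|A|.+1.
  move=> /subsetP sA hA; split.
    by apply: mono_setU1 => // x /sA /NP[].
  rewrite cardsU1; case: (boolP (v \in A)) => // /sA /NP[_].
  by rewrite eqxx.
have sNP c A : A \subset N c -> A \subset P.
  by move=> /subset_trans -> //; apply/subsetP => x /NP[].
have := expnS 2 (r + s).+1 => hpow.
(* Without [v], at least [2 * 2 ^ (r + s).+1 - 1] vertices remain, so the two color neighborhoods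
   cannot both be smaller than [2 ^ (r + s).+1]. *)
have [ht|hf] : 2 ^ (r + s).+1 <= #|N true| \/ 2 ^ (r + s).+1 <= #|N false|.
  move: hP; rewrite addSn addnS hpow cP; lia.
- have [||A [sA [[hA cA]|[hA cA]]]] := IH r s.+1 (N true); rewrite ?addnS //.
  + by lia.
  + have [hA' cA'] := ext _ _ sA hA.
    by exists (v |: A); split; [exact: subN sA | left; rewrite cA'].
  + by exists A; split; [exact: sNP sA | right].
- have [||A [sA [[hA cA]|[hA cA]]]] := IH r.+1 s (N false); rewrite ?addSn //.
  + by lia.
  + by exists A; split; [exact: sNP sA | left].
  + have [hA' cA'] := ext _ _ sA hA.
    by exists (v |: A); split; [exact: subN sA | right; rewrite cA'].
Qed.

Definition unavoidable_pattern h t := exists A B (c1 c2 c3 : bool),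
  [/\ [disjoint A & B], t <= #|A| /\ t <= #|B|, mono h c1 A /\ mono h c2 B,
      {in A & B, forall a b, h a b = c3} & ~~ ((c1 == c2) && (c2 == c3))].

(** Irreflexivity makes any two completely joined sets disjoint. *)
Definition color_rel h (c : bool) : rel T := fun x y => (x != y) && (h x y == c).

(* Ordered pairs are summed, but since a color class has about n^2 / 4 edges the
   density 1/8 is already available when each edge is counted only once. *)
Definition dense_color h (c : bool) :=
  #|T| * #|T| <= 8 * \sum_(x : T) #|[set y | color_rel h c x y]|.

(** A clique of color [c] on either side gives the second alternative; otherwise both cliques have
    the other color while [c] joins them. *)
Lemma pattern_or_mono h c M : symmetric h ->
    kst_bound (2 ^ (M + M)) <= #|T| -> dense_color h c ->
  unavoidable_pattern h M \/ exists2 A, mono h c A & M <= #|A|.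
Proof.
move=> hs hT dens.
have [|||A [B [_ _ tA tB hAB]]] :=
  @kovari_sos_turan (color_rel h c) setT setT (2 ^ (M + M)); rewrite ?cardsT //.
  apply: leq_trans dens _; rewrite leq_mul2l /=.
  rewrite [X in X <= _](eq_bigl (fun x => x \in [set: T])); last by move=> x; rewrite inE.
  by apply: leq_sum => x _; apply/subset_leq_card/subsetP => y; rewrite !inE.
have mono_large S : 2 ^ (M + M) <= #|S| ->
    exists c' S', [/\ S' \subset S, mono h c' S' & M <= #|S'|].
  by move=> /(ramsey hs)[S' [sS' [[mS' cS']|[mS' cS']]]]; [exists true|exists false]; exists S'.
have [cA [A' [sA mA lA]]] := mono_large _ tA.
have [cB [B' [sB mB lB]]] := mono_large _ tB.
have [EA|nA] := eqVneq cA c; first by right; exists A'; rewrite -?EA.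
have [EB|nB] := eqVneq cB c; first by right; exists B'; rewrite -?EB.
left; exists A', B', cA, cB, c; split=> //.
- rewrite disjoint_subset; apply/subsetP => x /(subsetP sA) xA.
  rewrite inE; apply: contraL (xA) => /(subsetP sB) xB.
  by apply/negP => _; have := hAB _ _ xA xB; rewrite /color_rel eqxx.
- move=> a b /(subsetP sA) aA /(subsetP sB) bB.
  by have /andP[_ /eqP] := hAB _ _ aA bB.
- by rewrite (negbTE nB) andbF.
Qed.

(** The successor in [M] pays for the one vertex that a red and a blue clique may share;
    [kst_bound t] vertices must survive its removal. The power [2 ^ (M + M)] is the Ramsey bound for
    cliques of size [M]. *)
Definition pattern_bound t :=
  let M := (t + kst_bound t).+1 in kst_bound (2 ^ (M + M)).

Lemma exists_unavoidable_pattern h t : symmetric h ->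
    pattern_bound t <= #|T| -> dense_color h true -> dense_color h false ->
  unavoidable_pattern h t.
Proof.
rewrite /pattern_bound; set M := (t + _).+1 => hs hT dt df.
have weaken : unavoidable_pattern h M -> unavoidable_pattern h t.
  move=> [A [B [c1 [c2 [c3 [dAB [lA lB] mAB hAB nc]]]]]].
  by exists A, B, c1, c2, c3; split=> //; rewrite /M in lA lB; lia.
have [/weaken//|[P mP lP]] := pattern_or_mono hs hT dt.
have [/weaken//|[Q mQ lQ]] := pattern_or_mono hs hT df.
have cPQ : #|P :&: Q| <= 1.
  rewrite leqNgt; apply/card_gt1P => -[x [y [/setIP[xP xQ] /setIP[yP yQ] nxy]]].
  by have := mP _ _ xP yP nxy; rewrite (mQ _ _ xQ yQ nxy).
have lPQ : kst_bound t <= #|P :\: Q|.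
  by have := cardsID Q P; rewrite /M in lP; lia.
have lQP : kst_bound t <= #|Q :\: P|.
  by have := cardsID P Q; rewrite setIC /M in lQ *; lia.
have dens : #|P :\: Q| * #|Q :\: P| =
    \sum_(a in P :\: Q) #|[set b in Q :\: P | h a b == true]| +
    \sum_(a in P :\: Q) #|[set b in Q :\: P | h a b == false]|.
  rewrite -big_split /= -sum_nat_const; apply: eq_bigr => a _.
  rewrite -(cardsID [set b | h a b] (Q :\: P)).
  congr (_ + _); apply: eq_card => x; rewrite !inE;
    by case: (h a x); rewrite ?andbT ?andbF.
(* The more frequent color takes at least half of the pairs, well above the required eighth. *)
have [c dc] : exists c, #|P :\: Q| * #|Q :\: P| <=
    8 * \sum_(a in P :\: Q) #|[set b in Q :\: P | h a b == c]|.
  rewrite dens; case: (leqP (\sum_(a in P :\: Q) #|[set b in Q :\: P | h a b == true]|)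
    (\sum_(a in P :\: Q) #|[set b in Q :\: P | h a b == false]|)) => ?;
  [exists false|exists true]; lia.
have [A [B [sA sB lA lB hAB]]] := kovari_sos_turan lPQ lQP dc.
exists A, B, true, false, c; split=> //.
- apply: disjointWl sA (disjointWr sB _).
  rewrite -setI_eq0; apply/eqP/setP => x; rewrite !inE.
  by case: (x \in P); rewrite ?andbF.
- split; [apply: monoS mP | apply: monoS mQ].
  + exact: subset_trans sA (subsetDl _ _).
  + exact: subset_trans sB (subsetDl _ _).
- by move=> a b aA bB; apply/eqP/hAB.
Qed.

End Ramsey.

(** * Cubic graphs *)

Section EdgeCounts.
Variable G : sgraph.
Implicit Types (S A : {set G}) (x y u v : G).

Lemma edgesP A : reflect (exists x y, adj x y /\ A = [set x; y]) (A \in edges G).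
Proof.
rewrite inE; apply: (iffP existsP) => [[x /existsP[y /andP[xy /eqP ->]]]|[x [y [xy ->]]]].
  by exists x, y.
by exists x; apply/existsP; exists y; rewrite xy eqxx.
Qed.

Lemma adj_neq x y : adj x y -> x != y.
Proof. by apply: contraTneq => ->; rewrite adj_irrefl. Qed.

Lemma set2_inj x y z : [set x; y] = [set x; z] -> y = z.
Proof.
move=> E; have := set22 x y; rewrite E => /set2P[yx|//].
by have := set22 x z; rewrite -E yx => /set2P[].
Qed.

Lemma adj_edge x y : ([set x; y] \in edges G) = adj x y.
Proof.
apply/edgesP/idP => [[u [v [uv E]]]|xy]; last by exists x, y.
have: u \in [set x; y] by rewrite E set21.
have: v \in [set x; y] by rewrite E set22.
have nuv := adj_neq uv.
case/set2P=> Ev /set2P[] Eu; move: uv nuv; rewrite Eu Ev ?eqxx //.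
by rewrite adj_sym.
Qed.

Lemma card_incident x : #|[set A in edges G | x \in A]| = degree x.
Proof.
rewrite /degree -(card_imset _ (@set2_inj x)); apply: eq_card => A.
apply/idP/imsetP => [|[y]]; last first.
  by rewrite inE => xy ->; rewrite in_set adj_edge xy set21.
rewrite in_set => /andP[/edgesP[u [v [uv ->]]] /set2P[]->]; first by exists v; rewrite ?inE.
by exists u; rewrite ?inE 1?adj_sym // setUC.
Qed.

Lemma sum_degree S : \sum_(x in S) degree x = \sum_(A in edges G) #|A :&: S|.
Proof.
transitivity (\sum_(x in S) \sum_(A in edges G) (x \in A)).
  apply: eq_bigr => x _; rewrite -card_incident -sum1dep_card big_mkcondr /=.
  by apply: eq_bigr => A _; case: (x \in A).
rewrite exchange_big; apply: eq_bigr => A _.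
rewrite -sum1_card; under [RHS]eq_bigl => x do rewrite inE andbC.
by rewrite [RHS]big_mkcondr; apply: eq_bigr => x _; case: (x \in A).
Qed.

Definition inner_edges S := [set A in edges G | A \subset S].
Definition cut_edges S :=
  [set A in edges G | ~~ (A \subset S) && ~~ (A \subset ~: S)].

(** An edge is counted once for each of its ends in [S]: twice if inner, once if cut. *)
Lemma sum_degree_cut S :
  \sum_(x in S) degree x = 2 * #|inner_edges S| + #|cut_edges S|.
Proof.
rewrite sum_degree /inner_edges /cut_edges -!sum1dep_card !big_mkcondr /=.
rewrite big_distrr -big_split /=; apply: eq_bigr => A /edgesP[x [y [xy ->]]].
have nxy := adj_neq xy.
rewrite !subUset !sub1set !inE setIUl.
have I1 z : [set z] :&: S = if z \in S then [set z] else set0.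
  apply/setP => w; case: ifP => zS; rewrite !inE; case: eqP => //= ->; exact: zS.
rewrite !I1; case: ifP => _; case: ifP => _; rewrite ?setU0 ?set0U ?cards0 ?cards1 //=.
by rewrite cards2 nxy.
Qed.

(** The three blocks partition the edges, and the booleans act as 0/1 weights. With [p] a color
    test, this counts a color in an embedded copy. *)
Lemma card_edges_by_block S (p : pred {set G}) (b1 b2 b3 : bool) :
    {in inner_edges S, forall A, p A = b1} ->
    {in inner_edges (~: S), forall A, p A = b2} ->
    {in cut_edges S, forall A, p A = b3} ->
  #|[set A in edges G | p A]| = b1 * #|inner_edges S| +
    b2 * #|inner_edges (~: S)| + b3 * #|cut_edges S|.
Proof.
move=> h1 h2 h3.
have countE (D : {set {set G}}) b : D \subset edges G -> {in D, forall A, p A = b} ->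
    b * #|D| = \sum_(A in edges G) (p A && (A \in D)).
  move=> /subsetP sD hb; rewrite -sum1_card big_distrr /= (big_mkcond (mem D)).
  rewrite [RHS]big_mkcond; apply: eq_bigr => A _ /=.
  case: (boolP (A \in D)) => [AD|_]; last by rewrite andbF; case: ifP.
  by rewrite (sD _ AD) hb // andbT muln1.
rewrite (countE _ _ _ h1) ?(countE _ _ _ h2) ?(countE _ _ _ h3) -?big_split /=;
  try by apply/subsetP => A; rewrite inE => /andP[].
rewrite -sum1dep_card big_mkcondr /=; apply: eq_bigr => A AE.
rewrite [A \in inner_edges S]in_set [A \in inner_edges (~: S)]in_set.
rewrite [A \in cut_edges S]in_set AE /=.
have: ~~ ((A \subset S) && (A \subset ~: S)).
  apply/negP => /andP[/subsetP s1 /subsetP s2].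
  move: AE => /edgesP[x [y [_ AE]]]; have xA : x \in A by rewrite AE set21.
  by have := s2 _ xA; rewrite inE (s1 _ xA).
by case: (p A); case: (_ \subset S); case: (_ \subset _).
Qed.

(** * Greedy enlargement of vertex sets *)

Definition closed_nbhd S := S :|: \bigcup_(x in S) [set y | adj x y].

Lemma closed_nbhdP S y :
  reflect (y \in S \/ exists2 x, x \in S & adj x y) (y \in closed_nbhd S).
Proof.
rewrite in_setU; apply: (iffP orP) => -[yS|].
- by left.
- by case/bigcupP=> x xS; rewrite inE => xy; right; exists x.
- by left.
- by case=> x xS xy; right; apply/bigcupP; exists x; rewrite ?inE.
Qed.

Lemma inner_edgesU1 S v : v \notin closed_nbhd S ->
  inner_edges (v |: S) = inner_edges S.
Proof.
move=> vN; have vS : v \notin S by apply: contra vN => vS; apply/closed_nbhdP; left.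
have nadj x : x \in S -> adj x v = false.
  by move=> xS; apply: contraNF vN => xv; apply/closed_nbhdP; right; exists x.
apply/setP => A; rewrite !inE; apply: andb_id2l.
move=> hA; have /edgesP[x [y [xy ->]]] : A \in edges G by rewrite inE.
rewrite !subUset !sub1set !inE.
have [xv|_] := eqVneq x v; have [yv|_] := eqVneq y v => //=.
- by move: xy; rewrite xv yv adj_irrefl.
- rewrite xv (negbTE vS) /=; apply/negP => yS.
  by have := nadj _ yS; rewrite adj_sym -xv xy.
- by rewrite yv (negbTE vS) andbF andbT; apply/negP => /nadj; rewrite -yv xy.
Qed.

Hypothesis cubicG : cubic G.

Lemma closed_nbhdU1 S v : #|closed_nbhd (v |: S)| <= #|closed_nbhd S| + 4.
Proof.
have sub : closed_nbhd (v |: S) \subset closed_nbhd S :|: (v |: [set y | adj v y]).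
  apply/subsetP => y /closed_nbhdP[/setU1P[->|yS]|[x /setU1P[->|xS] xy]].
  - by rewrite !inE eqxx ?orbT.
  - by rewrite inE; apply/orP; left; apply/closed_nbhdP; left.
  - by rewrite inE in_setU1 inE xy !orbT.
  - by rewrite inE; apply/orP; left; apply/closed_nbhdP; right; exists x.
apply: leq_trans (subset_leq_card sub) _.
apply: leq_trans (leq_card_setU _ _) _; rewrite leq_add2l.
by rewrite cardsU1 -/(degree v) cubicG inE adj_irrefl.
Qed.

(** The extra 4 on the right appears because a free vertex is last sought after only [j - 1]
    additions. *)
Lemma extend_independently S j : #|closed_nbhd S| + 4 * j < #|G| + 4 ->
  exists S', #|S'| = #|S| + j /\ inner_edges S' = inner_edges S.
Proof.
elim: j S => [|j IH] S hS; first by exists S; rewrite addn0.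
have [v vN] : exists v, v \notin closed_nbhd S.
  have : #|~: closed_nbhd S| > 0 by have := cardsC (closed_nbhd S); lia.
  by case/card_gt0P => v; rewrite inE => vN; exists v.
have vS : v \notin S by apply: contra vN => vS; apply/closed_nbhdP; left.
have [|S' [cS' iS']] := IH (v |: S); first by have := closed_nbhdU1 S v; lia.
exists S'; split; last by rewrite iS' inner_edgesU1.
by rewrite cS' cardsU1 vS; lia.
Qed.

(** Each end lies in the neighborhood of the other, so two neighborhoods of size 3 cover
    everything. *)
Lemma closed_nbhd_edge u v : adj u v -> #|closed_nbhd [set u; v]| <= 6.
Proof.
move=> uv.
have sub : closed_nbhd [set u; v] \subset [set y | adj u y] :|: [set y | adj v y].
  apply/subsetP => y /closed_nbhdP[/set2P[]->|[x /set2P[]->]]; rewrite !inE.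
  - by rewrite (adj_sym v) uv orbT.
  - by rewrite uv.
  - by move=> ->.
  - by move=> ->; rewrite orbT.
apply: leq_trans (subset_leq_card sub) _.
by apply: leq_trans (leq_card_setU _ _) _; rewrite -!/(degree _) !cubicG.
Qed.

Lemma inner_edges_edge u v : adj u v -> #|inner_edges [set u; v]| = 1.
Proof.
move=> uv; apply/eqP/cards1P; exists [set u; v]; apply/setP => A.
rewrite in_set1; apply/idP/eqP => [|->]; rewrite inE; last by rewrite adj_edge uv /=.
move=> /andP[/edgesP[x [y [xy ->]]]] sxy; apply/eqP.
by rewrite eqEcard sxy !cards2 (adj_neq xy) (adj_neq uv).
Qed.

Lemma cubic_halving_set : exists S : {set G},
  #|inner_edges S| <= 1 /\ #|cut_edges S| = #|inner_edges (~: S)|.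
Proof.
have sumE S : \sum_(x in S) degree x = 3 * #|S|.
  by rewrite (eq_bigr (fun=> 3)) ?sum_nat_const 1?mulnC // => x _; exact: cubicG.
(* The handshake identity makes the order even, leaving only the residues 0 and 2 modulo 4. *)
have even_order : 3 * #|G| = 2 * #|edges G|.
  have := sum_degree_cut [set: G]; rewrite sumE cardsT => ->.
  have -> : cut_edges [set: G] = set0 by apply/setP => A; rewrite !inE subsetT andbF.
  have -> : inner_edges [set: G] = edges G by apply/setP => A; rewrite inE subsetT andbT.
  by rewrite cards0 addn0.
have cutC S : cut_edges (~: S) = cut_edges S.
  by apply/setP => A; rewrite !inE setCK [X in _ && X]andbC.
(* The degree sum over [S] gives [#|cut_edges S| = #|~: S|]; the one over [~: S] then gives the same
   value for its inner edges. *)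
have suff_card S : 4 * #|S| = #|G| + 2 * #|inner_edges S| ->
    #|cut_edges S| = #|inner_edges (~: S)|.
  have := sum_degree_cut S; have := sum_degree_cut (~: S).
  rewrite !sumE cutC; have := cardsC S; lia.
pose k := #|G| %/ 4.
have [E|E] : #|G| = 4 * k \/ #|G| = 4 * k + 2 by rewrite /k; lia.
- have [|S [cS iS]] := @extend_independently set0 k.
    have -> : closed_nbhd set0 = set0 by rewrite /closed_nbhd big_set0 setU0.
    by rewrite cards0; lia.
  have i0 : inner_edges S = set0.
    rewrite iS; apply/setP => A; rewrite [LHS]inE in_set0 subset0.
    by apply/negP => /andP[/edgesP[x [y [_ ->]]]]; apply/negP/set0Pn; exists x; rewrite set21.
  exists S; rewrite i0 cards0; split=> //.
  by apply: suff_card; rewrite i0 cS !cards0; lia.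
- have /card_gt0P[u _] : 0 < #|G| by lia.
  have [v uv] : exists v, v \in [set y | adj u y].
    by apply/card_gt0P; rewrite -/(degree u) cubicG.
  rewrite inE in uv.
  (* The three neighbors of [u] rule out order 2, so an edge plus [k.-1] vertices makes [k + 1]. *)
  have k0 : 0 < k.
    by have := max_card [set y | adj u y]; rewrite -/(degree u) cubicG; lia.
  have [|S [cS iS]] := @extend_independently [set u; v] k.-1.
    by have := closed_nbhd_edge uv; lia.
  have i1 : #|inner_edges S| = 1 by rewrite iS inner_edges_edge.
  exists S; rewrite i1; split=> //.
  by apply: suff_card; rewrite i1 cS cards2 (adj_neq uv); lia.
Qed.

End EdgeCounts.

(** * Embedding into a pattern *)

Section Embedding.
Variables (n : nat) (phi : coloring n).
Implicit Types (A B : {set Kn n}).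

Definition pair_color : rel (Kn n) := fun x y => phi [set x; y].

Lemma pair_color_sym : symmetric pair_color.
Proof. by move=> x y; rewrite /pair_color setUC. Qed.

Lemma injection_into (U T : finType) (A : {set T}) : #|U| <= #|A| ->
  exists2 g : U -> T, injective g & forall x, g x \in A.
Proof.
move=> hA; exists (fun x => enum_val (widen_ord hA (enum_rank x))).
  by move=> x y /enum_val_inj/(congr1 val)/= /ord_inj/enum_rank_inj.
by move=> x; exact: enum_valP.
Qed.

Lemma injection_along (U T : finType) (S : {set U}) (A B : {set T}) :
    [disjoint A & B] -> #|U| <= #|A| -> #|U| <= #|B| ->
  exists2 f : U -> T, injective f & forall x, f x \in if x \in S then A else B.
Proof.
move=> dAB /injection_into[g gi gA] /injection_into[g' gi' gB].
exists (fun x => if x \in S then g x else g' x); last by move=> x; case: ifP.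
have ne x y : g x <> g' y.
  by move=> E; have := disjointFr dAB (gA x); rewrite E gB.
by move=> x y; case: ifP => _; case: ifP => _ E; [exact: gi|case: (ne x y)|case: (ne y x)|exact: gi'].
Qed.

(** Direct image along an injection is injective on vertex sets, so color counts can be made on the
    edges of [G]. *)
Lemma balanced_copy_of_embedding (G : sgraph) (f : G -> Kn n) :
    injective f ->
    let N c := #|[set A in edges G | phi (f @: A) == c]| in
    N Red <= N Blue + 1 -> N Blue <= N Red + 1 ->
  contains_balanced_copy phi G.
Proof.
move=> fi N hR hB.
pose F (A : {set G}) : {set Kn n} := f @: A.
have Fi : injective F := imset_inj fi.
pose D c := [set A in edges G | phi (F A) == c].
exists (f @: [set: G]), (F @: edges G); split.
- split; last by move=> _ /imsetP[A _ ->]; apply/imsetS/subsetT.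
  apply/subsetP => _ /imsetP[_ /edgesP[x [y [xy ->]]] ->].
  by rewrite /F imsetU1 imset_set1 adj_edge /= (inj_eq fi) (adj_neq xy).
- exists f; split=> // x y.
  have -> : [set f x; f y] = F [set x; y] by rewrite /F imsetU1 imset_set1.
  by rewrite mem_imset // adj_edge.
exists (F @: D Red), (F @: D Blue); split.
- suff -> : edges G = D Red :|: D Blue by rewrite imsetU.
  apply/setP => A; rewrite !inE -andb_orr.
  by case: (phi (F A)); rewrite andbT.
- rewrite -imsetI; last by move=> ? ? _ _; exact: Fi.
  suff -> : D Red :&: D Blue = set0 by rewrite imset0.
  apply/setP => A; rewrite !inE.
  by case: (phi (F A)); rewrite ?andbF.
- rewrite !card_imset // -/(N Red) -/(N Blue); lia.
- by move=> _ /imsetP[A + ->]; rewrite inE => /andP[_ /eqP].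
- by move=> _ /imsetP[A + ->]; rewrite inE => /andP[_ /eqP].
Qed.

Lemma balanced_copy_of_blocks (G : sgraph) (S : {set G}) A B (c1 c2 c3 : bool) :
    #|inner_edges S| <= 1 -> #|cut_edges S| = #|inner_edges (~: S)| ->
    [disjoint A & B] -> #|G| <= #|A| -> #|G| <= #|B| ->
    mono pair_color c1 A -> mono pair_color c2 B ->
    {in A & B, forall a b, pair_color a b = c3} -> c2 != c3 ->
  contains_balanced_copy phi G.
Proof.
move=> hS hcut dAB lA lB mA mB hAB nc.
have [f fi fAB] := injection_along S dAB lA lB.
have inA x : x \in S -> f x \in A by move=> xS; have := fAB x; rewrite xS.
have inB x : x \notin S -> f x \in B by move=> xS; have := fAB x; rewrite (negbTE xS).
have colE x y : phi (f @: [set x; y]) = pair_color (f x) (f y).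
  by rewrite imsetU1 imset_set1.
have h1 : {in inner_edges S, forall E : {set G}, phi (f @: E) = c1}.
  move=> E; rewrite inE => /andP[/edgesP[x [y [xy ->]]]].
  rewrite subUset !sub1set colE => /andP[xS yS].
  by apply: mA; rewrite ?inA // (inj_eq fi) adj_neq.
have h2 : {in inner_edges (~: S), forall E : {set G}, phi (f @: E) = c2}.
  move=> E; rewrite inE => /andP[/edgesP[x [y [xy ->]]]].
  rewrite subUset !sub1set !in_setC colE => /andP[xS yS].
  by apply: mB; rewrite ?inB // (inj_eq fi) adj_neq.
have h3 : {in cut_edges S, forall E : {set G}, phi (f @: E) = c3}.
  move=> E; rewrite inE => /andP[/edgesP[x [y [xy ->]]]].
  rewrite !subUset !sub1set !in_setC colE.
  case: (boolP (x \in S)) => xS; case: (boolP (y \in S)) => yS //= _.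
    by rewrite hAB ?inA ?inB.
  by rewrite pair_color_sym hAB ?inA ?inB.
have count c : #|[set E in edges G | phi (f @: E) == c]| =
    ~~ (c1 (+) c) * #|inner_edges S| + ~~ (c2 (+) c) * #|inner_edges (~: S)| +
    ~~ (c3 (+) c) * #|cut_edges S|.
  have eqE (b : bool) : (b == c :> color) = ~~ (b (+) c) by case: b; case: c.
  by apply: card_edges_by_block => E hE; rewrite eqE ?(h1 _ hE) ?(h2 _ hE) ?(h3 _ hE).
(* Colors [c2] and [c3] each receive [j] edges, so the two counts differ by exactly [i <= 1]. *)
apply: (balanced_copy_of_embedding fi); rewrite !count hcut /Red /Blue;
  move: hS nc; move: #|inner_edges S| #|inner_edges (~: S)| => i j hi;
  case: (c1) (c2) (c3) => [] [] [] //= _; lia.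
Qed.

Lemma dense_color_class (c : bool) : 4 <= n ->
  'C(n, 2)./2 <= #|color_class phi c| -> dense_color pair_color c.
Proof.
move=> n4 hc; rewrite /dense_color card_ord.
have hle : #|color_class phi c| <= \sum_(x : Kn n) #|[set y | color_rel pair_color c x y]|.
  pose D := [set u : Kn n * Kn n | color_rel pair_color c u.1 u.2].
  have -> : \sum_(x : Kn n) #|[set y | color_rel pair_color c x y]| = #|D|.
    rewrite -sum1dep_card -(pair_big_dep xpredT (color_rel pair_color c) (fun _ _ => 1)).
    by apply: eq_bigr => x _; rewrite sum1dep_card.
  apply: leq_trans (leq_imset_card (fun u => [set u.1; u.2]) D).
  apply/subset_leq_card/subsetP => E; rewrite inE => /andP[/edgesP[x [y [xy ->]]] hE].
  by apply/imsetP; exists (x, y); rewrite // inE /color_rel /= hE andbT; exact: (adj_neq xy).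
(* Here [8 * 'C(n, 2)./2] is at least [2 * n * (n - 1) - 4], which is at least [n * n] once
   [n >= 4]. *)
have := bin2 n; nia.
Qed.

End Embedding.

(** * From patterns to the existence of the balancing number *)

Lemma balanced_copy_of_pattern n (phi : coloring n) (G : sgraph) : cubic G ->
  unavoidable_pattern (pair_color phi) #|G| -> contains_balanced_copy phi G.
Proof.
move=> hG [A [B [c1 [c2 [c3 [dAB [lA lB] [mA mB] hAB nc]]]]]].
have [S [iS cS]] := cubic_halving_set hG.
have [E|n23] := eqVneq c2 c3; last exact: (balanced_copy_of_blocks iS cS dAB lA lB mA mB hAB).
apply: (balanced_copy_of_blocks iS cS _ lB lA mB mA (c3 := c3)).
- by rewrite disjoint_sym.
- by move=> b a bB aA; rewrite pair_color_sym hAB.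
- by move: nc; rewrite E eqxx andbT.
Qed.

(** Well-ordering for an arbitrary proposition-valued predicate such as [bal_bound n G], hence the
    classical case split. *)
Lemma ex_least (P : nat -> Prop) m : P m -> exists k, P k /\ forall k', P k' -> k <= k'.
Proof.
have [j] := ubnP m; elim: j m => // j IH m hm Pm.
have [[k' [Pk' lk']]|none] := classic (exists k', P k' /\ k' < m).
  by apply: IH Pk'; lia.
exists m; split=> // k' Pk'; rewrite leqNgt; apply/negP => lk'.
by apply: none; exists k'.
Qed.

Theorem theorem5p1 (G : sgraph) (hG : cubic G) : balanceable G.
Proof.
exists (pattern_bound #|G| + 4) => n hn.
have C2 : 1 <= 'C(n, 2)./2.
  have n4 : 4 <= n by lia.
  by have := bin2 n; nia.
(* This is the largest admissible candidate: exceeding it means having at least ['C(n, 2)./2] edges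
   of each color. *)
apply: (@ex_least _ ('C(n, 2)./2).-1); split; first by lia.
move=> phi hR hB; apply: balanced_copy_of_pattern => //.
by apply: exists_unavoidable_pattern; [exact: pair_color_sym | rewrite card_ord; lia | |];
  apply: dense_color_class; rewrite /Red /Blue in hR hB; lia.
Qed.
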